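(* Let $\varepsilon_{\mathbb C}:\mathbb C\langle X_1,X_2,\dots\rangle\rightarrow\mathbb C$ be the unital algebra homomorphism with $\varepsilon_{\mathbb C}(X_k)=1$ for all $k\in\mathbb N$. For all $i\in\mathbb N$ and $t,x\in\mathbb C$, $$\varepsilon_{\mathbb C}\bigl(\widetilde{\mathcal P}_i(xX_1,\dots,xX_i;t)\bigr)=\sum_{i_1+\cdots+i_k=i}(t-i_1+1)(t-i_1-i_2+1)\cdots(t-i+1)\,x^k=(xt+1)(x(t-1)+1)\cdots(x(t-i+2)+1)\,x(t-i+1).$$ In particular, $$\varepsilon_{\mathbb C}\bigl(\mathcal P_i(X_1,\dots,X_i)\bigr)=\sum_{i_1+\cdots+i_k=i}(i-i_1+1)(i-i_1-i_2+1)\cdots1=\frac{(i+1)!}{2}.$$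
   Context: $\mathbb C\langle X_1,X_2,\dots\rangle$ is the free associative unital algebra in noncommutative variables. Generalized displacement polynomials: $\widetilde{\mathcal P}_i(X_1,\dots,X_i;t)=\sum_{i_1+\cdots+i_k=i}p_{i_1,\dots,i_k}(t)\,X_{i_k}\cdots X_{i_1}$ with $p_{i_1,\dots,i_k}(t)=(t-i_1+1)(t-i_1-i_2+1)\cdots(t-i_1-\cdots-i_k+1)$; displacement polynomials: $\mathcal P_i(X_1,\dots,X_i):=\widetilde{\mathcal P}_i(X_1,\dots,X_i;i)$. Sums over $i_1+\cdots+i_k=i$ run over all $k\in\{1,\dots,i\}$ and all $(i_1,\dots,i_k)\in\mathbb N^k$ with sum $i$. The product $(xt+1)(x(t-1)+1)\cdots(x(t-i+2)+1)$ means $\prod_{s=0}^{i-2}(x(t-s)+1)$, which is empty (equal to $1$) for $i=1$. *)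

(* Defs.v *)
From HB Require Import structures.
From mathcomp Require Import all_boot all_order all_algebra.
From mathcomp Require Import reals complex monalg.

Set Implicit Arguments.
Unset Strict Implicit.
Unset Printing Implicit Defensive.

Import Order.TTheory GRing.Theory Num.Theory.
Local Open Scope ring_scope.

(* The free algebra C<X_1, X_2, ...>: finitely supported C-linear combinations
   of words, with concatenation of words as product. The letter n : nat stands
   for the variable X_(n+1). *)
Notation freeAlg R := {malg (complex R)[{fmonom nat}]}.

(* Variables are indexed from 1; the value at k = 0 is never used. *)
Definition X (R : realType) (k : nat) : freeAlg R := << fmu k.-1 >>.

(* c = (i_1, ..., i_k), with i_(j+1) = c j, is a composition of i.
   Each part of a composition of i is at most i, so taking values in 'I_i.+1
   loses none. *)
Definition is_comp (i k : nat) (c : {ffun 'I_k -> 'I_i.+1}) : bool :=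
  [forall j, 0 < c j]%N && (\sum_(j < k) c j == i)%N.

Definition pcoef (K : nzRingType) (i k : nat) (c : {ffun 'I_k -> 'I_i.+1})
    (t : K) : K :=
  \prod_(m < k) (t - \sum_(j < k | (j <= m)%N) (c j)%:R + 1).

(* The generalized displacement polynomial evaluated at Y 1, ..., Y i; the
   use of rev_ord gives the reversed word Y i_k * ... * Y i_1. *)
Definition gdisp (K : nzRingType) (A : lalgType K) (i : nat) (Y : nat -> A)
    (t : K) : A :=
  \sum_(1 <= k < i.+1) \sum_(c : {ffun 'I_k -> 'I_i.+1} | is_comp c)
    pcoef c t *: \prod_(j < k) Y (c (rev_ord j)).

Definition disp (K : nzRingType) (A : lalgType K) (i : nat) (Y : nat -> A) : A :=
  gdisp i Y i%:R.

Definition const1 (R : realType) (m : {fmonom nat}) : complex R := 1.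

Lemma const1_mmorphism (R : realType) : mmorphism (const1 R).
Proof. by split=> // m1 m2; rewrite /const1 mulr1. Qed.

HB.instance Definition _ (R : realType) :=
  isMultiplicative.Build {fmonom nat} (complex R) (const1 R)
    (const1_mmorphism R).

Lemma augmentation_exists (R : realType) :
  exists eps : {lrmorphism freeAlg R -> complex R | *%R},
    forall k : nat, (0 < k)%N -> eps (X R k) = 1.
Proof. by exists (mmap idfun (const1 R)) => k _; rewrite /= mmapU mulr1. Qed.

(* Main.v *)
(* Splitting off the last part of a composition and summing over all
   compositions of [n], with [S n] the weighted sum
   and [T n = S 0 + ... + S n], one gets [S n.+1 = x (t - n) T n], hence
   [T n.+1 = (x (t - n) + 1) T n], and both sums are products. *)
Require Import Defs.
From mathcomp Require Import all_boot all_order all_algebra.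
From mathcomp Require Import reals complex monalg.
From mathcomp Require Import ring zify.

Set Implicit Arguments.
Unset Strict Implicit.
Unset Printing Implicit Defensive.

Import Order.TTheory GRing.Theory Num.Theory.
Local Open Scope ring_scope.

Definition ffun_rcons (T : Type) (k : nat) (p : {ffun 'I_k -> T} * T) :
    {ffun 'I_k.+1 -> T} :=
  [ffun j => if unlift ord_max j is Some j' then p.1 j' else p.2].

Lemma ffun_rcons_widen (T : Type) (k : nat) (c : {ffun 'I_k -> T}) (a : T)
    (j : 'I_k) :
  ffun_rcons (c, a) (widen_ord (leqnSn k) j) = c j.
Proof.
rewrite ffunE; have -> : widen_ord (leqnSn k) j = lift ord_max j.
  by apply: val_inj; rewrite /= /bump leqNgt ltn_ord.
by rewrite liftK.
Qed.

Lemma ffun_rcons_max (T : Type) (k : nat) (c : {ffun 'I_k -> T}) (a : T) :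
  ffun_rcons (c, a) ord_max = a.
Proof. by rewrite ffunE unlift_none. Qed.

Lemma ffun_rcons_bij (T : Type) (k : nat) : bijective (@ffun_rcons T k).
Proof.
exists (fun c : {ffun 'I_k.+1 -> T} =>
  ([ffun j => c (lift ord_max j)], c ord_max)) => [[c a]|c].
  congr (_, _); last exact: ffun_rcons_max.
  by apply/ffunP => j; rewrite !ffunE liftK.
by apply/ffunP => j; rewrite ffunE; case: unliftP => [j'|] -> //=; rewrite ffunE.
Qed.

(* The parts are bounded by a fixed [N], not by the composed number [i], so that
   the type of [c] does not change along the recursion. *)
Definition is_bcomp (N k i : nat) (c : {ffun 'I_k -> 'I_N.+1}) : bool :=
  [forall j, 0 < c j]%N && (\sum_(j < k) c j == i)%N.

Definition comp_sum (K : nzRingType) (t : K) (N k i : nat) : K :=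
  \sum_(c : {ffun 'I_k -> 'I_N.+1} | is_bcomp i c) pcoef c t.

(** Subtraction in [nat] is truncated, so the guard [a <= i] is what makes [i - a] the true sum of
    the remaining parts. *)
Lemma is_bcomp_rcons (N k i : nat) (c : {ffun 'I_k -> 'I_N.+1}) (a : 'I_N.+1) :
  is_bcomp i (ffun_rcons (c, a)) = (0 < a <= i)%N && is_bcomp (i - a) c.
Proof.
rewrite /is_bcomp big_ord_recr /= ffun_rcons_max.
under eq_bigr do rewrite ffun_rcons_widen.
have -> : [forall j, 0 < ffun_rcons (c, a) j]%N
        = (0 < a)%N && [forall j, 0 < c j]%N.
  apply/forallP/andP => [H|[a_gt0 /forallP c_gt0] j].
    split; first by have := H ord_max; rewrite ffun_rcons_max.
    by apply/forallP => j; have := H (widen_ord (leqnSn k) j);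
      rewrite ffun_rcons_widen.
  by rewrite ffunE; case: unliftP.
by case: [forall j, _]; rewrite ?andbF //= ?andbT; lia.
Qed.

(** The last factor of [pcoef] contains the sum of all parts, which is [i] whatever the last part
    is. It can therefore be pulled out of the sum over compositions. *)
Lemma pcoef_rcons (K : nzRingType) (t : K) (N k i : nat)
    (c : {ffun 'I_k -> 'I_N.+1}) (a : 'I_N.+1) :
  is_bcomp i (ffun_rcons (c, a)) ->
  pcoef (ffun_rcons (c, a)) t = pcoef c t * (t - i%:R + 1).
Proof.
case/andP => _ /eqP sum_c; rewrite /pcoef big_ord_recr /=; congr (_ * _).
  apply: eq_bigr => m _; congr (_ - _ + _).
  (* The appended part has index [k > m], so it does not enter the earlier partial sums. *)
  rewrite big_mkcond big_ord_recr /= leqNgt ltn_ord addr0 -big_mkcond /=.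
  by apply: eq_bigr => j _; rewrite ffun_rcons_widen.
rewrite -sum_c natr_sum; congr (_ - _ + _).
by apply: eq_bigl => j; rewrite -ltnS ltn_ord.
Qed.

(** Removing a last part [a] with [0 < a <= i] leaves a composition of [j = i - a < i]. Since
    [i <= N], every such [a] is available in ['I_N.+1]. *)
Lemma comp_sumS (K : comNzRingType) (t : K) (N k i : nat) : (i <= N)%N ->
  comp_sum t N k.+1 i = (t - i%:R + 1) * \sum_(j < i) comp_sum t N k j.
Proof.
move=> iN; rewrite /comp_sum (reindex _ (onW_bij _ (ffun_rcons_bij _ k))) /=.
rewrite (eq_bigr (fun p => (t - i%:R + 1) * pcoef p.1 t)); last first.
  by case=> c a /pcoef_rcons ->; rewrite mulrC.
rewrite -big_distrr /=; congr (_ * _).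
rewrite (eq_bigl (fun p : {ffun 'I_k -> 'I_N.+1} * 'I_N.+1 =>
    (0 < p.2 <= i)%N && is_bcomp (i - p.2) p.1)); last first.
  by case=> c a; rewrite is_bcomp_rcons.
rewrite -(pair_big_dep xpredT (fun c (a : 'I_N.+1) =>
  (0 < a <= i)%N && is_bcomp (i - a) c) (fun c _ => pcoef c t)) /=.
rewrite (exchange_big_dep (fun a : 'I_N.+1 => (0 < a <= i)%N)) /=; last first.
  by move=> c a _ /andP[].
pose F a := \sum_(c : {ffun 'I_k -> 'I_N.+1} | is_bcomp a c) pcoef c t.
transitivity (\sum_(a < N.+1 | (0 < a <= i)%N) F (i - a)%N).
  by apply: eq_bigr => a ha; apply: eq_bigl => c; rewrite ha.
rewrite -(big_mkord (fun a => (0 < a <= i)%N) (fun a => F (i - a)%N)).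
(* The substitution [j = i - a] is a reversal of the range followed by a shift by one; the range is
   then widened to that of [a]. *)
rewrite -(big_mkord xpredT F) [RHS]big_nat_rev /= add0n.
rewrite -[RHS](big_add1 _ _ 0 i.+1 xpredT (fun a => F (i - a)%N)).
rewrite [RHS](big_nat_widen _ _ N.+1) // [RHS](big_nat_widenl _ 0) //.
by apply: eq_bigl => a; rewrite /= ltnS andbC.
Qed.

Lemma comp_sum0 (K : nzRingType) (t : K) (N i : nat) :
  comp_sum t N 0 i = (i == 0%N)%:R.
Proof.
rewrite /comp_sum; have bcompE (c : {ffun 'I_0 -> 'I_N.+1}) :
    is_bcomp i c = (i == 0%N).
  rewrite /is_bcomp big_ord0 eq_sym andb_idl // => _.
  by apply/forallP => -[].
rewrite (eq_bigl _ _ bcompE); case: (i == 0%N); last by rewrite big_pred0_eq.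
rewrite (eq_bigr (fun=> 1)) => [|c _]; last by rewrite /pcoef big_ord0.
by rewrite sumr_const card_ffun !card_ord.
Qed.

(** There are no compositions to sum over, because [k] positive parts add up to at least [k]. *)
Lemma comp_sum_eq0 (K : comNzRingType) (t : K) (N k i : nat) :
  (i <= N)%N -> (i < k)%N -> comp_sum t N k i = 0.
Proof.
elim: k i => // k IHk i iN ik; rewrite comp_sumS // big1 ?mulr0 // => j _.
by apply: IHk; have := ltn_ord j; lia.
Qed.

(** This is [S i] for [i <= N]: the terms with [k > i] vanish. A range of [k] independent of [i]
    allows the sums over [i] and [k] to be exchanged. *)
Definition comp_poly (K : nzRingType) (t x : K) (N i : nat) : K :=
  \sum_(k < N.+1) comp_sum t N k i * x ^+ k.

Lemma comp_poly0 (K : comNzRingType) (t x : K) (N : nat) :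
  comp_poly t x N 0 = 1.
Proof.
rewrite /comp_poly big_ord_recl comp_sum0 mulr1 big1 ?addr0 // => k _.
by rewrite comp_sum_eq0 // mul0r.
Qed.

Lemma comp_polyS (K : comNzRingType) (t x : K) (N n : nat) : (n < N)%N ->
  comp_poly t x N n.+1
    = x * (t - n%:R) * \sum_(j < n.+1) comp_poly t x N j.
Proof.
(* The term [k = 0] on the left vanishes because [n.+1] is nonzero, and the term [k = N] on the
   right because [j <= n < N]. The remaining terms match after shifting [k] by one, which yields the
   factor [x]. *)
move=> nN; rewrite /comp_poly exchange_big /= big_ord_recl big_ord_recr /=.
rewrite comp_sum0 mul0r add0r [X in _ * (_ + X)]big1 ?addr0 => [|j _]; last first.
  by rewrite comp_sum_eq0 ?mul0r //; have := ltn_ord j; lia.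
rewrite mulr_sumr; apply: eq_bigr => k _.
rewrite comp_sumS // -mulr_suml exprS -natr1; ring.
Qed.

Lemma sum_comp_poly (K : comNzRingType) (t x : K) (N n : nat) : (n <= N)%N ->
  \sum_(j < n.+1) comp_poly t x N j = \prod_(s < n) (x * (t - s%:R) + 1).
Proof.
elim: n => [_|n IHn nN]; first by rewrite big_ord1 big_ord0 comp_poly0.
rewrite big_ord_recr /= comp_polyS // IHn; last exact: ltnW.
rewrite big_ord_recr /=; ring.
Qed.

Lemma sum_pcoef (K : comNzRingType) (t x : K) (i : nat) : (0 < i)%N ->
  \sum_(1 <= k < i.+1) \sum_(c : {ffun 'I_k -> 'I_i.+1} | is_comp c)
      pcoef c t * x ^+ k
  = (\prod_(s < i.-1) (x * (t - s%:R) + 1)) * (x * (t - i%:R + 1)).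
Proof.
case: i => // n _ /=.
(* With [N = i], [is_bcomp] unfolds to [is_comp]; only the vanishing term [k = 0] is extra. *)
transitivity (comp_poly t x n.+1 n.+1).
  rewrite /comp_poly -(big_mkord xpredT (fun k => comp_sum t n.+1 k n.+1 * x ^+ k)).
  rewrite [RHS]big_ltn // comp_sum0 mul0r add0r.
  by apply: eq_bigr => k _; rewrite -mulr_suml.
rewrite comp_polyS // sum_comp_poly // -natr1; ring.
Qed.

(** The factors run from [n + 2] down to [3], so only the factor [2] of the factorial is missing. *)
Lemma prod_half_fact (K : numFieldType) (n : nat) :
  \prod_(s < n) (n.+1%:R - s%:R + 1) = n.+2`!%:R / 2%:R :> K.
Proof.
elim: n => [|n IHn]; first by rewrite big_ord0 divff // pnatr_eq0.
rewrite big_ord_recl subr0 natr1 factS natrM -mulrA -IHn; congr (_ * _).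
apply: eq_bigr => s _; rewrite lift0 -!natr1; ring.
Qed.

(** All parts are positive, so each of the [k] letters of a word is sent to [x], and the order of
    the letters is irrelevant. *)
Lemma eps_gdisp (K : comNzRingType) (A : lalgType K)
    (eps : {lrmorphism A -> K | *%R}) (i : nat) (Y : nat -> A) (t x : K) :
  (forall k, (0 < k)%N -> eps (Y k) = x) ->
  eps (gdisp i Y t)
    = \sum_(1 <= k < i.+1) \sum_(c : {ffun 'I_k -> 'I_i.+1} | is_comp c)
        pcoef c t * x ^+ k.
Proof.
move=> epsY; rewrite rmorph_sum; apply: eq_bigr => k _.
rewrite rmorph_sum; apply: eq_bigr => c /andP[/forallP c_gt0 _].
rewrite /= linearZ_LR rmorph_prod /=; congr (_ * _).
by under eq_bigr => j _ do rewrite epsY //; rewrite prodr_const card_ord.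
Qed.

Theorem proposition6p12 (R : realType)
    (eps : {lrmorphism freeAlg R -> complex R | *%R})
    (heps : forall k : nat, (0 < k)%N -> eps (X R k) = 1)
    (i : nat) (hi : (0 < i)%N) :
  (forall t x : complex R,
     eps (gdisp i (fun k => x *: X R k) t)
       = \sum_(1 <= k < i.+1) \sum_(c : {ffun 'I_k -> 'I_i.+1} | is_comp c)
           pcoef c t * x ^+ k
     /\ \sum_(1 <= k < i.+1) \sum_(c : {ffun 'I_k -> 'I_i.+1} | is_comp c)
           pcoef c t * x ^+ k
       = (\prod_(s < i.-1) (x * (t - s%:R) + 1)) * (x * (t - i%:R + 1)))
  /\ (eps (disp i (X R))
       = \sum_(1 <= k < i.+1) \sum_(c : {ffun 'I_k -> 'I_i.+1} | is_comp c)
           pcoef c (i%:R : complex R)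
     /\ \sum_(1 <= k < i.+1) \sum_(c : {ffun 'I_k -> 'I_i.+1} | is_comp c)
           pcoef c (i%:R : complex R)
       = (i.+1)`!%:R / 2%:R).
Proof.
split=> [t x|].
  split; last exact: sum_pcoef.
  by apply: eps_gdisp => k k_gt0; rewrite linearZ /= heps ?mulr1.
have sum1 : \sum_(1 <= k < i.+1) \sum_(c : {ffun 'I_k -> 'I_i.+1} | is_comp c)
      pcoef c (i%:R : complex R)
    = \sum_(1 <= k < i.+1) \sum_(c : {ffun 'I_k -> 'I_i.+1} | is_comp c)
        pcoef c (i%:R : complex R) * 1 ^+ k.
  by apply: eq_bigr => k _; apply: eq_bigr => c _; rewrite expr1n mulr1.
rewrite {}sum1; split; first exact: eps_gdisp.
(* At [t = i] and [x = 1] the separate last factor equals [1]. *)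
rewrite sum_pcoef // subrr add0r !mulr1.
case: i hi => // n _; rewrite -prod_half_fact /=.
by apply: eq_bigr => s _; rewrite mul1r.
Qed.
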